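(* Let $k \in \mathbb{Z}$ and $n \in\mathbb{Z}^+$ with $n\geq 2$ and $k\not\equiv 0\pmod n$, and let $R_4$ be the regular infinite square tiling of the plane (the graph on $\mathbb{Z}\times\mathbb{Z}$ with $(i,j)$ adjacent to $(i\pm1,j)$ and $(i,j\pm1)$). Then $\chi_{(n,k)}(R_4) = 2$ if $(4,n) \mid k$, and $\chi_{(n,k)}(R_4) = 4$ otherwise.
   Context: $(a,b)$ denotes the greatest common divisor. For a graph $G=(V,E)$, a $\mathbb{Z}$-labeling is a map $\ell:V\to\mathbb{Z}$; its order is the size of its range; it is proper if adjacent vertices get different labels. $N(v)$ is the open neighborhood of $v$. An open coloring with remainder $k \bmod n$ is a labeling with $\sum_{w\in N(v)}\ell(w)\equiv k \pmod n$ for all $v\in V$. $\chi_{(n,k)}(G)$ is the minimum order of a proper open coloring with remainder $k\bmod n$ (when one of finite order exists). *)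

(* Defs.v *)
From mathcomp Require Import all_boot all_order all_algebra.
From mathcomp Require Import boolp classical_sets functions cardinality fsbigop.

Set Implicit Arguments.
Unset Strict Implicit.
Unset Printing Implicit Defensive.

Import Order.TTheory GRing.Theory Num.Theory.

Local Open Scope classical_set_scope.
Local Open Scope card_scope.
Local Open Scope ring_scope.

(* Simple graphs, possibly infinite. Local finiteness is what makes the sum of
   the labels over an open neighborhood meaningful. *)
Record lfgraph := LFGraph {
  vertex :> choiceType;
  adj : rel vertex;
  adj_sym : symmetric adj;
  adj_irr : irreflexive adj;
  adj_finite : forall v, finite_set [set w | adj v w] }.

Section Colorings.
Variable G : lfgraph.
Implicit Type l : G -> int.

Definition open_nbhd (v : G) : set G := [set w | adj v w].

Definition proper_labeling l := forall v w : G, adj v w -> l v != l w.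

Definition has_order l (m : nat) := range l #= `I_m.

Definition open_coloring (n : nat) (k : int) l :=
  forall v : G, (\sum_(w \in open_nbhd v) l w = k %[mod n])%Z.

Definition chi_attains (n : nat) (k : int) : pred nat := fun m =>
  `[< exists l, [/\ proper_labeling l, open_coloring n k l & has_order l m] >].

(* None when there is no proper open coloring of finite order. *)
Definition chi (n : nat) (k : int) : option nat :=
  if pselect (exists m, chi_attains n k m) is left ex_m
  then Some (ex_minn ex_m) else None.

End Colorings.

Definition square_nbrs (v : int * int) : seq (int * int) :=
  [:: (v.1 + 1, v.2); (v.1 - 1, v.2); (v.1, v.2 + 1); (v.1, v.2 - 1)].

Definition square_adj : rel (int * int) := fun v w => w \in square_nbrs v.

Lemma square_adj_sym : symmetric square_adj.
Proof.
suff sub v w : square_adj v w -> square_adj w v.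
  by move=> v w; apply/idP/idP; apply: sub.
case: v => i j; rewrite /square_adj !inE => /or4P[] /eqP-> /=;
  by rewrite ?addrK ?subrK eqxx ?orbT.
Qed.

Lemma square_adj_irr : irreflexive square_adj.
Proof.
move=> [i j]; apply/negbTE; rewrite /square_adj !inE !xpair_eqE !eqxx /=.
by rewrite !andbT -![_ == _ + _]subr_eq0 !opprD !addrA !subrr.
Qed.

Lemma square_adj_finite v : finite_set [set w | square_adj v w].
Proof. exact: finite_seq. Qed.

Definition R4 : lfgraph :=
  LFGraph square_adj_sym square_adj_irr square_adj_finite.

(* Main.v *)
(* If [(4, n) %| k], pick [a] with [4 a = k] mod [n] and label the two color
   classes of the checkerboard by [a] and [a + n]. In general, put [k] on a set
   meeting every neighborhood exactly once, 0 elsewhere, and add [n] on the odd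
   color class.

   If [(4, n)] does not divide [k], no neighborhood is monochromatic, so at least
   three labels occur; moreover either [n] is even and [k] odd, or [4 %| n] and
   [k = 2] mod 4. With exactly three labels [a, b, c], the neighbors of a vertex
   labeled [c] are labeled [a] or [b]. If all neighborhood sums are odd, then
   [a + b], [b + c] and [c + a] are all odd, which is absurd. If all sums are 2 mod
   4, then [a, b, c] are distinct mod 4, so two of them differ by 2 mod 4 and the
   third has the opposite parity, which fails locally around the third one. *)

Require Import Defs.
From mathcomp Require Import all_boot all_order all_algebra.
From mathcomp Require Import finmap zify ring.
From mathcomp Require Import boolp classical_sets functions cardinality fsbigop.

Set Implicit Arguments.
Unset Strict Implicit.
Unset Printing Implicit Defensive.

Import Order.TTheory GRing.Theory Num.Theory.

Local Open Scope classical_set_scope.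
Local Open Scope card_scope.
Local Open Scope ring_scope.

(** * Orders as lists of labels, colorings in coordinates *)

Lemma has_orderP (G : lfgraph) (l : G -> int) (m : nat) :
  has_order l m <->
  exists s : seq int,
    [/\ uniq s, size s = m & forall x, x \in s <-> exists v, l v = x].
Proof.
split=> [lm|[s [us <- sP]]].
  have /finite_seqP[s rl] : finite_set (range l) by apply/finite_setP; exists m.
  have rX : range l = [set` [fset x in s]%fset].
    by rewrite rl; apply/seteqP; split=> x /=; rewrite inE.
  exists (undup s); split; first exact: undup_uniq.
    by rewrite -card_fseq; apply/card_eq_fsetP; rewrite -rX.
  move=> x; rewrite mem_undup; have -> : (x \in s) = (x \in [set` s]) :> Prop.
    by rewrite in_setE.
  by rewrite -rl in_setE /=; split=> -[v] => [_ <-|<-]; exists v.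
rewrite /has_order.
have -> : range l = [set` [fset x in s]%fset].
  apply/seteqP; split=> x /=; rewrite inE.
    by move=> [v _ <-]; apply/sP; exists v.
  by move=> /sP[v <-]; exists v.
by apply/card_eq_fsetP; rewrite card_fseq undup_id.
Qed.

Lemma chi_eq (G : lfgraph) (n : nat) (k : int) (m : nat) :
  chi_attains G n k m -> (forall p, chi_attains G n k p -> (m <= p)%N) ->
  chi G n k = Some m.
Proof.
move=> atm minm; rewrite /chi; case: pselect => [ex_m|]; last by case; exists m.
congr Some; case: ex_minnP => p /minm mp /(_ m atm) pm.
by apply/eqP; rewrite eqn_leq mp pm.
Qed.

Definition square_sum (l : int * int -> int) (i j : int) : int :=
  l (i + 1, j) + l (i - 1, j) + l (i, j + 1) + l (i, j - 1).

Lemma square_nbrs_uniq v : uniq (square_nbrs v).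
Proof. by case: v => i j; rewrite /square_nbrs /= !inE !xpair_eqE; lia. Qed.

Lemma open_coloring_R4 (n : nat) (k : int) (l : R4 -> int) :
  open_coloring n k l <-> forall i j, (n %| square_sum l i j - k)%Z.
Proof.
have sumE i j : \sum_(w \in open_nbhd ((i, j) : R4)) l w = square_sum l i j.
  have -> : open_nbhd ((i, j) : R4) = [set` square_nbrs (i, j)] by [].
  rewrite -fsbig_seq ?square_nbrs_uniq //.
  by rewrite /square_nbrs !big_cons big_nil /= addr0 !addrA.
split=> [lk i j|lk [i j]].
  by rewrite -eqz_mod_dvd -sumE; apply/eqP; apply: lk.
by apply/eqP; rewrite sumE eqz_mod_dvd.
Qed.

Lemma proper_labeling_R4 (l : R4 -> int) :
  proper_labeling l <->
  forall i j, l (i, j) != l (i + 1, j) /\ l (i, j) != l (i, j + 1).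
Proof.
split=> [pl i j|pl [i j] w].
  by split; apply: pl; rewrite /= /square_adj !inE eqxx ?orbT.
rewrite /= /square_adj !inE => /or4P[] /eqP-> /=.
- by have [] := pl i j.
- by have [+ _] := pl (i - 1) j; rewrite subrK eq_sym.
- by have [] := pl i j.
- by have [_] := pl i (j - 1); rewrite subrK eq_sym.
Qed.

(** * Proper labelings with three labels *)

Section ThreeLabels.
Variables (l : int * int -> int) (a b c : int).
Hypothesis proper_l :
  forall i j, l (i, j) != l (i + 1, j) /\ l (i, j) != l (i, j + 1).
Hypothesis l_abc : forall v, l v = a \/ l v = b \/ l v = c.

Lemma nbr_labels i j : l (i, j) = c ->
  [/\ l (i + 1, j) = a \/ l (i + 1, j) = b, l (i - 1, j) = a \/ l (i - 1, j) = b,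
      l (i, j + 1) = a \/ l (i, j + 1) = b & l (i, j - 1) = a \/ l (i, j - 1) = b].
Proof.
move=> lc.
have [h1 h2] := proper_l i j; have [h3 _] := proper_l (i - 1) j.
have [_ h4] := proper_l i (j - 1); rewrite subrK in h3; rewrite subrK in h4.
have notc v : l v != c -> l v = a \/ l v = b.
  by case: (l_abc v) => [->|[->|->]]; rewrite ?eqxx //; [left|right].
by split; apply: notc; rewrite -lc // eq_sym.
Qed.

(** Four labels taken from [a] and [b] have an even sum when [a] and [b] have the same parity. *)
Lemma odd_sum_labels i j q :
  l (i, j) = c -> square_sum l i j = 2 * q + 1 -> ~~ (2 %| a + b)%Z.
Proof.
rewrite /square_sum => /nbr_labels[] H1 H2 H3 H4 Hs.
by case: H1 H2 H3 H4 Hs => -> [] -> [] -> [] ->; lia.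
Qed.

(** If [a] and [b] agree mod 4, four labels taken from them sum to [4 * a], that is 0, mod 4. *)
Lemma two_mod4_labels i j q :
  l (i, j) = c -> square_sum l i j = 4 * q + 2 -> ~~ (4 %| a - b)%Z.
Proof.
rewrite /square_sum => /nbr_labels[] H1 H2 H3 H4 Hs.
by case: H1 H2 H3 H4 Hs => -> [] -> [] -> [] ->; lia.
Qed.

(* If [c] sits at the center, a corner between differently labeled neighbors of
   the center is labeled [c]. The neighbors split 3-1 between [a] and [b], so the
   minority neighbor sees three [c]s, and its sum is odd or [4 * c]. *)
Lemma no_two_mod4 i j : l (i, j) = c ->
  (4 %| a - b - 2)%Z -> ~~ (2 %| a - c)%Z ->
  (forall i j, exists q, square_sum l i j = 4 * q + 2) -> False.
Proof.
move=> lc ab ac sums.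
have no_three x y z t : x = c -> y = c -> z = c -> (t = a \/ t = b \/ t = c) ->
  (exists q, x + y + z + t = 4 * q + 2) -> False.
  by move=> -> -> -> [|[]] -> [q]; lia.
have cornerE x y z : (x = a \/ x = b) -> (y = a \/ y = b) ->
  (z = a \/ z = b \/ z = c) -> z != x -> z != y -> x = y \/ z = c.
  by move=> [] -> [] ->; lia.
have [HE HW HN HS] := nbr_labels lc.
have NE : l (i + 1, j) = l (i, j + 1) \/ l (i + 1, j + 1) = c.
  apply: cornerE => //; rewrite eq_sym; first by have [] := proper_l (i + 1) j.
  by have [] := proper_l i (j + 1).
have SE : l (i + 1, j) = l (i, j - 1) \/ l (i + 1, j - 1) = c.
  apply: cornerE => //; last by rewrite eq_sym; have [] := proper_l i (j - 1).
  by have [_] := proper_l (i + 1) (j - 1); rewrite subrK.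
have NW : l (i - 1, j) = l (i, j + 1) \/ l (i - 1, j + 1) = c.
  apply: cornerE => //; first by rewrite eq_sym; have [] := proper_l (i - 1) j.
  by have [+ _] := proper_l (i - 1) (j + 1); rewrite subrK.
have SW : l (i - 1, j) = l (i, j - 1) \/ l (i - 1, j - 1) = c.
  apply: cornerE => //; first by have [_] := proper_l (i - 1) (j - 1); rewrite subrK.
  by have [+ _] := proper_l (i - 1) (j - 1); rewrite subrK.
have E3 : l (i + 1, j + 1) = c -> l (i + 1, j - 1) = c -> False.
  move=> h1 h2; apply: (no_three _ _ _ (l (i + 1 + 1, j)) lc h1 h2) => //.
  by have [q] := sums (i + 1) j; rewrite /square_sum addrK => Hq; exists q; rewrite -Hq; ring.
have W3 : l (i - 1, j + 1) = c -> l (i - 1, j - 1) = c -> False.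
  move=> h1 h2; apply: (no_three _ _ _ (l (i - 1 - 1, j)) lc h1 h2) => //.
  by have [q] := sums (i - 1) j; rewrite /square_sum subrK => Hq; exists q; rewrite -Hq; ring.
have N3 : l (i + 1, j + 1) = c -> l (i - 1, j + 1) = c -> False.
  move=> h1 h2; apply: (no_three _ _ _ (l (i, j + 1 + 1)) lc h1 h2) => //.
  by have [q] := sums i (j + 1); rewrite /square_sum addrK => Hq; exists q; rewrite -Hq; ring.
have S3 : l (i + 1, j - 1) = c -> l (i - 1, j - 1) = c -> False.
  move=> h1 h2; apply: (no_three _ _ _ (l (i, j - 1 - 1)) lc h1 h2) => //.
  by have [q] := sums i (j - 1); rewrite /square_sum subrK => Hq; exists q; rewrite -Hq; ring.
(* As [a - b] is 2 mod 4, a 4-0 or 2-2 split of the neighbors would give a sum divisible by 4. In a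
   3-1 split both corners next to the minority neighbor are [c], against one of [E3], [W3], [N3],
   [S3]. *)
have [q] := sums i j; rewrite /square_sum.
by case: HE HW HN HS NE SE NW SW => -> [] -> [] -> [] -> NE SE NW SW Hq; lia.
Qed.
End ThreeLabels.

Lemma three_labels_sums (l : int * int -> int) (a b c : int) :
  (forall i j, l (i, j) != l (i + 1, j) /\ l (i, j) != l (i, j + 1)) ->
  (forall v, l v = a \/ l v = b \/ l v = c) ->
  (exists v, l v = a) -> (exists v, l v = b) -> (exists v, l v = c) ->
  ~ (forall i j, exists q, square_sum l i j = 2 * q + 1) /\
  ~ (forall i j, exists q, square_sum l i j = 4 * q + 2).
Proof.
move=> pl labc [[ia ja] la] [[ib jb] lb] [[ic jc] lc].
(* The section lemmas single out the third label; cyclic rotations give each label that role. *)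
have lbca v : l v = b \/ l v = c \/ l v = a by case: (labc v) => [|[]]; auto.
have lcab v : l v = c \/ l v = a \/ l v = b by case: (labc v) => [|[]]; auto.
split=> sums.
  have [qa /(odd_sum_labels pl lbca la) Ha] := sums ia ja.
  have [qb /(odd_sum_labels pl lcab lb) Hb] := sums ib jb.
  have [qc /(odd_sum_labels pl labc lc) Hc] := sums ic jc.
  lia.
have [qa /(two_mod4_labels pl lbca la) Ha] := sums ia ja.
have [qb /(two_mod4_labels pl lcab lb) Hb] := sums ib jb.
have [qc /(two_mod4_labels pl labc lc) Hc] := sums ic jc.
have [ab|[bc|ca]] : (4 %| a - b - 2 \/ 4 %| b - c - 2 \/ 4 %| c - a - 2)%Z by lia.
- by apply: (no_two_mod4 pl labc lc ab) => //; lia.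
- by apply: (no_two_mod4 pl lbca la bc) => //; lia.
- by apply: (no_two_mod4 pl lcab lb ca) => //; lia.
Qed.

(** * Lower bounds on the order *)

Lemma order_ge2 (l : R4 -> int) (m : nat) :
  proper_labeling l -> has_order l m -> (2 <= m)%N.
Proof.
move=> /proper_labeling_R4 pl /has_orderP[s [us <- sP]].
have [l01 _] := pl 0 0.
apply: (uniq_leq_size (s1 := [:: l (0, 0); l (0 + 1, 0)])).
  by rewrite /= inE l01.
by move=> x; rewrite !inE => /orP[] /eqP->; apply/sP; eexists.
Qed.

Lemma order_ge4 (l : R4 -> int) (m : nat) :
  proper_labeling l ->
  (forall i j, exists q, square_sum l i j = 2 * q + 1) \/
  (forall i j, exists q, square_sum l i j = 4 * q + 2) ->
  has_order l m -> (4 <= m)%N.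
Proof.
move=> /proper_labeling_R4 pl sums /has_orderP[s [us <- sP]].
rewrite leqNgt; apply/negP => s3.
have [xE xN] := pl 0 0; have [xW _] := pl (0 - 1) 0; have [_ xS] := pl 0 (0 - 1).
rewrite !subrK in xW xS.
(* The third label sits on a neighbor of the origin: four equal labels would sum to a multiple of
   4. *)
have [w wx wy] : exists2 w, l w != l (0, 0) & l w != l (0 + 1, 0).
  have [NE|] := eqVneq (l (0, 0 + 1)) (l (0 + 1, 0)); last first.
    by exists (0, 0 + 1); rewrite // eq_sym.
  have [WE|] := eqVneq (l (0 - 1, 0)) (l (0 + 1, 0)); last by exists (0 - 1, 0).
  have [SE|] := eqVneq (l (0, 0 - 1)) (l (0 + 1, 0)); last by exists (0, 0 - 1).
  by case: sums => /(_ 0 0) [q]; rewrite /square_sum NE WE SE; move: (l _) => y; lia.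
pose t := [:: l (0, 0); l (0 + 1, 0); l w].
have ut : uniq t by rewrite /= !inE negb_or xE eq_sym wx eq_sym wy.
have ts : {subset t <= s}.
  by move=> x; rewrite !inE => /or3P[] /eqP->; apply/sP; eexists.
have [_ tE] := uniq_min_size ut ts s3.
have labc v : l v = l (0, 0) \/ l v = l (0 + 1, 0) \/ l v = l w.
  have /sP : exists u, l u = l v by exists v.
  by rewrite -tE !inE => /or3P[] /eqP; auto.
have [] := three_labels_sums pl labc; try by eexists.
by case: sums.
Qed.

(** * Colorings with two and with four labels *)

Lemma chi_attains_2 (n : nat) (k : int) :
  (0 < n)%N -> (gcdz 4 n %| k)%Z -> chi_attains R4 n k 2.
Proof.
move=> n0 /dvdzP[t kE]; have [u [v uv]] := Bezoutz 4 n.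
(* Multiplying [u * 4 + v * n = gcdz 4 n] by [t] gives [4 * a = k - t * v * n]. *)
pose a : int := u * t.
pose f (p : int * int) : int := if (2 %| p.1 + p.2)%Z then a else a + n.
have fS i j : [/\ f (i + 1, j) = f (i - 1, j), f (i, j + 1) = f (i, j - 1)
    & f (i + 1, j) = f (i, j + 1)].
  by rewrite /f /=; split; congr (if _ then _ else _); lia.
apply/asboolP; exists f; split.
- by apply/proper_labeling_R4 => i j; rewrite /f /=; split; do 2 case: ifP; lia.
- apply/open_coloring_R4 => i j; rewrite /square_sum.
  have [<- <- ->] := fS i j; rewrite {1 2 3 4}/f.
  have -> : k = t * (u * 4 + v * n) by rewrite uv.
  case: ifP => _; apply/dvdzP; [exists (- (t * v))|exists (4 - t * v)];
    rewrite /a; ring.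
apply/has_orderP; exists [:: a; a + n]; split=> //=; first by rewrite inE; lia.
move=> x; rewrite !inE; split.
  by case/orP => /eqP->; [exists (0, 0)|exists (1, 0)].
by case=> p <-; rewrite /f; case: ifP; rewrite eqxx ?orbT.
Qed.

(** A total perfect code: horizontal dominoes on the even rows, with period 4 along a row and
    shifted by 2 from one even row to the next. *)
Definition perfect_code (v : int * int) : bool :=
  (2 %| v.2)%Z && ((4 %| v.1 + v.2)%Z || (4 %| v.1 + v.2 - 1)%Z).

(** Exactly two neighbors lie in even rows: the horizontal ones for even [j], the vertical ones for
    odd [j]. Their coordinate sums differ by 2, so exactly one of these sums is 0 or 1 mod 4. *)
Lemma perfect_codeP (i j : int) :
  (perfect_code (i + 1, j)%R + perfect_code (i - 1, j)%R +
   perfect_code (i, j + 1)%R + perfect_code (i, j - 1)%R)%N = 1%N.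
Proof. by rewrite /perfect_code /=; lia. Qed.

Lemma chi_attains_4 (n : nat) (k : int) :
  (0 < n)%N -> ~~ (n %| k)%Z -> chi_attains R4 n k 4.
Proof.
move=> n_gt0 nk.
pose f (p : int * int) : int :=
  k *+ perfect_code p + n%:Z *+ ~~ (2 %| p.1 + p.2)%Z.
(* An odd vertex's label minus an adjacent even vertex's label is [n], [n + k] or [n - k]. So
   excluding 0, [n] and [-n] as values of [k] makes [f] proper; it also makes the four labels
   distinct. *)
have k0 : k != 0 by apply: contraNneq nk => ->; rewrite dvdz0.
have n0 : n%:Z != 0 by lia.
have kn : k != n by apply: contraNneq nk => ->.
have kNn : k != - n%:Z by apply: contraNneq nk => ->; rewrite dvdzE abszN.
apply/asboolP; exists f; split.
- apply/proper_labeling_R4 => i j; rewrite /f /=.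
  have -> : (2 %| i + 1 + j)%Z = ~~ (2 %| i + j)%Z by lia.
  have -> : (2 %| i + (j + 1))%Z = ~~ (2 %| i + j)%Z by lia.
  by case: (perfect_code _); case: (perfect_code _); case: (perfect_code _);
    case: (2 %| _)%Z; rewrite /= ?mulr1n ?mulr0n; lia.
- apply/open_coloring_R4 => i j; rewrite /square_sum /f /=.
  pose o (x y : int) : int := (~~ (2 %| x + y)%Z)%:R.
  (* The quotient counts the neighbors in the odd color class. *)
  apply/dvdzP; exists (o (i + 1) j + o (i - 1) j + o i (j + 1) + o i (j - 1)).
  rewrite /o -[k in _ - k]mulr1n -(perfect_codeP i j) !mulrnDr -!(mulr_natr n%:Z).
  by ring.
apply/has_orderP; exists [:: 0; k; n%:Z; k + n]; split=> //=.
  by rewrite !inE; lia.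
move=> x; rewrite !inE; split.
  by case/or4P => /eqP->; [exists (2, 0)|exists (0, 0)|exists (3, 0)|exists (1, 0)];
    rewrite /f /= ?mulr1n ?mulr0n ?addr0 ?add0r.
by case=> p <-; rewrite /f; case: perfect_code; case: (2 %| _)%Z;
  rewrite /= ?mulr1n ?mulr0n ?addr0 ?add0r ?eqxx ?orbT.
Qed.

Theorem theorem6p7 (k : int) (n : nat) (hn : (2 <= n)%N)
    (hk : (k <> 0 %[mod n])%Z) :
  chi R4 n k = Some (if (gcdz 4 n %| k)%Z then 2%N else 4%N).
Proof.
case: ifPn => [dk|dNk]; apply: chi_eq.
- by apply: chi_attains_2 => //; apply: ltnW.
- by move=> p /asboolP[l [pl _]]; apply: order_ge2.
- apply: chi_attains_4; [exact: ltnW|].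
  by apply/dvdz_mod0P => k0; apply: hk; rewrite k0 mod0z.
move=> p /asboolP[l [pl /open_coloring_R4 lk lm]]; apply: order_ge4 pl _ lm.
have dvd_sum (d : nat) i j : (d %| n)%N -> (d %| square_sum l i j - k)%Z.
  by move=> dn; apply: dvdz_trans (lk i j); rewrite dvdzE.
have gcdE : gcdz 4 n = gcdn 4 (n %% 4) by rewrite gcdn_modr.
have n4 : (n %% 4 < 4)%N by rewrite ltn_mod.
have d2 : ~~ (2 %| k)%Z -> (2 %| n)%N ->
    forall i j, exists q, square_sum l i j = 2 * q + 1.
  move=> k2 n2 i j; exists ((square_sum l i j - 1) %/ 2)%Z.
  by have := dvd_sum 2 i j n2; lia.
have d4 : (2 %| k)%Z -> ~~ (4 %| k)%Z -> (4 %| n)%N ->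
    forall i j, exists q, square_sum l i j = 4 * q + 2.
  move=> k2 k4 n2 i j; exists ((square_sum l i j - 2) %/ 4)%Z.
  by have := dvd_sum 4 i j n2; lia.
(* For odd [n] the gcd is 1 and divides [k]. For [n] equal to 2 mod 4 it is 2, so [k] is odd; for
   [n] divisible by 4 it is 4, so [k] is odd or 2 mod 4. *)
move: dNk; rewrite gcdE; case En: (n %% 4)%N n4 => [|[|[|[|]]]] //= _ dNk.
- have [k2|k2] := boolP (2 %| k)%Z; [right; apply: d4|left; apply: d2] => //; lia.
- by rewrite dvd1z in dNk.
- by left; apply: d2 => //; lia.
- by rewrite dvd1z in dNk.
Qed.
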